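(* Let $F$ be a field, let $n,N$ be positive integers, let $(A_1,A_2,\dots,A_N)$ be an $N$-tuple of $n\times n$ matrices over $F$, and let $Q$ be an $n\times n$ matrix over $F$. If $N\ge n+1$, then $$\sum_{k=0}^{N}(-1)^k\sum_{\substack{\sigma\subset[N]\\ |\sigma|=k}}\operatorname{per}\Bigl(Q+\sum_{i\in\sigma}A_i\Bigr)=0 .$$
   Context: Here $[N]=\{1,2,\dots,N\}$, the inner sum runs over all subsets $\sigma$ of $[N]$ of cardinality $k$, and the sum over the empty set is the zero matrix. For an $n\times n$ matrix $M=(m_{ij})$, the permanent is $\operatorname{per}(M)=\sum_{\pi\in S_n}\prod_{i=1}^n m_{i,\pi(i)}$, where $S_n$ is the symmetric group on $\{1,\dots,n\}$. *)

(* Defs.v *)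
From mathcomp Require Import all_boot all_fingroup all_algebra.

Set Implicit Arguments.
Unset Strict Implicit.
Unset Printing Implicit Defensive.

Import GRing.Theory.
Local Open Scope ring_scope.

Definition permanent (R : comNzRingType) (n : nat) (M : 'M[R]_n) : R :=
  \sum_(s : 'S_n) \prod_(i < n) M i (s i).

(* Main.v *)
Require Import Defs.
From mathcomp Require Import all_boot all_fingroup all_algebra.

Set Implicit Arguments.
Unset Strict Implicit.
Unset Printing Implicit Defensive.

Import GRing.Theory.
Local Open Scope ring_scope.

(** Each product of the permanent is a polynomial of degree n in the indicator
    variables of sigma, so all its monomials miss some index of [N]; toggling
    a missed index in sigma cancels the signed sum of that monomial. *)

Lemma sum_sign_set_superset (R : pzRingType) (T : finType) (S : {set T}) :
  (#|S| < #|T|)%N ->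
  \sum_(s : {set T}) (-1) ^+ #|s| * (S \subset s)%:R = 0 :> R.
Proof.
move=> ltST; have [j jS] : exists j, j \notin S.
  apply/existsP; rewrite -negb_forall; apply: contraL ltST => /forallP inS.
  by rewrite -leqNgt -cardsT subset_leq_card //; apply/subsetP.
rewrite (bigID (fun s : {set T} => j \in s)) /=.
(* The bijection toggling j, rather than an involution argument giving only
   x = - x, keeps the lemma valid in characteristic 2. *)
rewrite (reindex_onto (fun s => j |: s) (fun s => s :\ j)) /=; last first.
  by move=> s; apply: setD1K.
rewrite (eq_bigl (fun s : {set T} => j \notin s)); last first.
  move=> s; rewrite setU11 /=; apply/eqP/idP => [<-|]; last exact: setU1K.
  by rewrite !inE eqxx.
rewrite -big_split big1 //= => s js.
(* Since [j] lies outside [S], adding it to [s] flips the sign but leaves the indicator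
   unchanged. *)
rewrite cardsU1 js exprS mulN1r mulNr.
suff -> : (S \subset j |: s) = (S \subset s) by rewrite addNr.
by rewrite -subDset (_ : S :\ j = S) //; apply/setDidPl; rewrite disjoint_sym disjoints1.
Qed.

(* The factor [S \subset s] collects the indicator variables of the factors
   already expanded, which makes the induction on r go through. *)
Lemma sum_sign_set_prod_superset (R : comPzRingType) (T : finType) (I : Type)
    (r : seq I) (q : I -> R) (a : I -> T -> R) (S : {set T}) :
  (size r + #|S| < #|T|)%N ->
  \sum_(s : {set T}) (-1) ^+ #|s| *
     (\prod_(i <- r) (q i + \sum_(j in s) a i j) * (S \subset s)%:R) = 0.
Proof.
elim: r S => [|i r IHr] S ltT.
  by under eq_bigr do rewrite big_nil mul1r; exact: sum_sign_set_superset.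
pose G (U s : {set T}) := (-1) ^+ #|s| *
  (\prod_(i <- r) (q i + \sum_(j in s) a i j) * (U \subset s)%:R).
(* Expand the factor of [i]: [q i] leaves [S] alone, while the term of [j] requires [j \in s], which
   merges with [S \subset s] into [j |: S \subset s]. *)
rewrite (eq_bigr (fun s => q i * G S s + \sum_j a i j * G (j |: S) s)).
  rewrite big_split /= -mulr_sumr IHr ?mulr0 ?add0r; last exact: ltnW.
  rewrite exchange_big big1 //= => j _; rewrite -mulr_sumr IHr ?mulr0 //.
  (* Dropping [i] from the list pays for the at most one element that [j] adds to [S]. *)
  by rewrite (leq_ltn_trans _ ltT) // addSnnS leq_add2l cardsU1 -add1n leq_add2r leq_b1.
move=> s _; rewrite big_cons -mulrA mulrCA mulrDl; congr (_ + _).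
rewrite big_mkcond mulr_suml; apply: eq_bigr => j _.
rewrite /G subUset sub1set; case: (j \in s) => //=.
by rewrite !mulr0 mul0r.
Qed.

Lemma sum_sign_set_permanent (R : comNzRingType) (T : finType) (n : nat)
    (A : T -> 'M[R]_n) (Q : 'M[R]_n) :
  (n < #|T|)%N ->
  \sum_(s : {set T}) (-1) ^+ #|s| * permanent (Q + \sum_(i in s) A i) = 0.
Proof.
move=> ltnT; under eq_bigr do rewrite /permanent mulr_sumr.
rewrite exchange_big big1 //= => p _.
(* For fixed [p] there are [n] factors, one per row; [set0] makes the indicator equal to 1. *)
rewrite -[RHS](@sum_sign_set_prod_superset _ _ _ (index_enum 'I_n)
  (fun i => Q i (p i)) (fun i j => A j i (p i)) set0); last first.
  by rewrite cards0 addn0 /index_enum -enumT size_enum_ord.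
apply: eq_bigr => s _; rewrite sub0set mulr1; congr (_ * _).
by apply: eq_bigr => i _; rewrite mxE summxE.
Qed.

Theorem mainTheorem3 (F : fieldType) (n N : nat) (hn : (0 < n)%N) (hN : (0 < N)%N)
    (A : 'I_N -> 'M[F]_n) (Q : 'M[F]_n) (hNn : (n + 1 <= N)%N) :
  \sum_(0 <= k < N.+1)
     (-1) ^+ k * \sum_(sigma : {set 'I_N} | #|sigma| == k)
                    permanent (Q + \sum_(i in sigma) A i) = 0.
Proof.
rewrite -[RHS](@sum_sign_set_permanent _ 'I_N _ A Q); last first.
  by rewrite card_ord -addn1.
(* This bound turns [#|s|] into an element of ['I_N.+1], by which the subsets are then grouped. *)
have cardN (s : {set 'I_N}) : (#|s| < N.+1)%N.
  by rewrite ltnS -[leqRHS]card_ord max_card.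
rewrite big_mkord [RHS](partition_big (fun s => Ordinal (cardN s)) predT) //=.
apply: eq_bigr => k _; rewrite mulr_sumr.
by apply: eq_big => // s /eqP ->.
Qed.
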